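(* Let $f_1=f_1(x^3)$ and $f_2=f_2(x^3)$ be nowhere zero smooth functions on $\mathbb R^3$ depending only on $x^3$, let $f_3=k_3\in\mathbb R\setminus\{0\}$ be constant, and let $g=\frac{1}{f_1^2}dx^1\otimes dx^1+\frac{1}{f_2^2}dx^2\otimes dx^2+\frac{1}{k_3^2}dx^3\otimes dx^3$. Then a vector field $V=\sum_{k=1}^3V^kE_k$, with $V^1,V^2,V^3$ smooth functions on $\mathbb R^3$ and $V^3=c\in\mathbb R$ constant, is a Killing vector field on $(\mathbb R^3,g)$ if and only if one of the following four assertions holds: (A) $V^1(x^3)=\frac{c_1}{f_1(x^3)}$, $V^2(x^3)=\frac{c_2}{f_2(x^3)}$, $V^3=0$, for some $c_1,c_2\in\mathbb R$; (B) $$V^1(x^1,x^3)=\frac{k_3c\bar{c_1}x^1+\hat{c_1}}{c_1e^{\bar{c_1}x^3}},\quad V^2(x^2,x^3)=\frac{k_3c\bar{c_2}x^2+\hat{c_2}}{c_2e^{\bar{c_2}x^3}},\quad V^3=c,$$ for some $\bar{c_1},\bar{c_2},\hat{c_1},\hat{c_2}\in\mathbb R$ and $c,c_1,c_2\in\mathbb R\setminus\{0\}$, and $f_i(x^3)=c_ie^{\bar{c_i}x^3}$ for $i\in\{1,2\}$; (C) $$V^1(x^2,x^3)=\frac{k_0}{f_2(x^3)}x^2+\frac{c_1}{f_1(x^3)},\quad V^2(x^1,x^3)=-\frac{k_0}{f_1(x^3)}x^1+\frac{c_2}{f_2(x^3)},\quad V^3=0,$$ for some $c_1,c_2\in\mathbb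 R$ and $k_0\in\mathbb R\setminus\{0\}$, and $\frac{f_1}{f_2}$ is constant; (D) $$V^1(x^1,x^2,x^3)=\frac{k_0}{c_2e^{\bar cx^3}}x^2+\frac{k_3c\bar cx^1+\hat{c_1}}{c_1e^{\bar cx^3}}+\tilde{c_1},$$ $$V^2(x^1,x^2,x^3)=-\frac{k_0}{c_1e^{\bar cx^3}}x^1+\frac{k_3c\bar cx^2+\hat{c_2}}{c_2e^{\bar cx^3}}+\tilde{c_2},$$ $$V^3=c,$$ for some $\bar c,\hat{c_1},\hat{c_2},\tilde{c_1},\tilde{c_2}\in\mathbb R$ and $c,c_1,c_2,k_0\in\mathbb R\setminus\{0\}$, and $f_i(x^3)=c_ie^{\bar cx^3}$ for $i\in\{1,2\}$, such that $\bar c(\tilde{c_1}^2+\tilde{c_2}^2)=0$.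
   Context: $x^1,x^2,x^3$ are the standard coordinates on $\mathbb R^3$. The orthonormal frame for $g$ is $E_1=f_1\frac{\partial}{\partial x^1}$, $E_2=f_2\frac{\partial}{\partial x^2}$, $E_3=k_3\frac{\partial}{\partial x^3}$. Displaying arguments such as $V^1(x^3)$ or $V^1(x^1,x^3)$ means that the function depends only on the displayed coordinates. The symbols $c_i,\bar{c_i},\hat{c_i},\tilde{c_i}$ denote independent real constants. A vector field $V$ is a Killing vector field if $\pounds_V g=0$, i.e. $V(g(X,Y))-g([V,X],Y)-g(X,[V,Y])=0$ for all tangent vector fields $X,Y$ on $\mathbb R^3$. *)

(* Defs.v *)
From HB Require Import structures.
From mathcomp Require Import all_boot all_order all_algebra.
From mathcomp Require Import all_classical all_reals all_analysis.
Set Implicit Arguments.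
Unset Strict Implicit.
Unset Printing Implicit Defensive.
Import Order.TTheory GRing.Theory Num.Theory.
Import numFieldNormedType.Exports.
Local Open Scope ring_scope.

(* Points of R^3, and tangent vectors in the basis of coordinate fields, are
   row vectors of type 'rV[R]_3; the coordinate x^k is [x 0 ik]. *)
Definition i1 : 'I_3 := @Ordinal 3 0 isT.
Definition i2 : 'I_3 := @Ordinal 3 1 isT.
Definition i3 : 'I_3 := @Ordinal 3 2 isT.

Definition scalar_field (R : realType) := 'rV[R]_3 -> R.
Definition vector_field (R : realType) := 'rV[R]_3 -> 'rV[R]_3.

Definition coord_field (R : realType) (i : 'I_3) : vector_field R :=
  fun _ => delta_mx 0 i.

Definition partial (R : realType) (i : 'I_3) (h : scalar_field R) :
    scalar_field R :=
  fun x => 'D_(delta_mx 0 i) h x.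

(* [class_C k h]: all iterated partial derivatives of h of order at most k
   exist and are continuous on R^3. The explicit [derivable] is needed because
   'D is total. *)
Fixpoint class_C (R : realType) (k : nat) (h : scalar_field R) : Prop :=
  continuous h /\
  match k with
  | 0%N => True
  | k'.+1 => forall i : 'I_3,
      (forall x, derivable h x (delta_mx 0 i)) /\ class_C k' (partial i h)
  end.

Definition smooth (R : realType) (h : scalar_field R) : Prop :=
  forall k : nat, class_C k h.

Definition smooth_field (R : realType) (X : vector_field R) : Prop :=
  forall i : 'I_3, smooth (fun x => X x 0 i).

Definition depends_only_on (R : realType) (i : 'I_3) (h : scalar_field R) :
    Prop :=
  forall x y : 'rV[R]_3, x 0 i = y 0 i -> h x = h y.

Definition vf_apply (R : realType) (X : vector_field R) (h : scalar_field R) :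
    scalar_field R :=
  fun x => \sum_(i < 3) X x 0 i * partial i h x.

Definition lie_bracket (R : realType) (X Y : vector_field R) :
    vector_field R :=
  fun x => \row_(i < 3) (vf_apply X (fun y => Y y 0 i) x
                         - vf_apply Y (fun y => X y 0 i) x).

Definition metric_field (R : realType) :=
  'rV[R]_3 -> 'rV[R]_3 -> 'rV[R]_3 -> R.

Definition metric (R : realType) (f1 f2 f3 : scalar_field R) :
    metric_field R :=
  fun x u v => 1 / f1 x ^+ 2 * (u 0 i1 * v 0 i1)
             + 1 / f2 x ^+ 2 * (u 0 i2 * v 0 i2)
             + 1 / f3 x ^+ 2 * (u 0 i3 * v 0 i3).

Definition frame_field (R : realType) (i : 'I_3) (f : scalar_field R) :
    vector_field R :=
  fun x => f x *: coord_field i x.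

(* The field V^1 E_1 + V^2 E_2 + V^3 E_3. *)
Definition of_frame (R : realType) (f1 f2 f3 V1 V2 V3 : scalar_field R) :
    vector_field R :=
  fun x => V1 x *: frame_field i1 f1 x + V2 x *: frame_field i2 f2 x
         + V3 x *: frame_field i3 f3 x.

Definition lie_derivative_metric (R : realType) (g : metric_field R)
    (V X Y : vector_field R) : scalar_field R :=
  fun x => vf_apply V (fun y => g y (X y) (Y y)) x
         - g x (lie_bracket V X x) (Y x)
         - g x (X x) (lie_bracket V Y x).

Definition killing (R : realType) (g : metric_field R) (V : vector_field R) :
    Prop :=
  forall X Y : vector_field R, smooth_field X -> smooth_field Y ->
  forall x, lie_derivative_metric g V X Y x = 0.

(* Main.v *)
Require Import Defs.
From HB Require Import structures.
From mathcomp Require Import all_boot all_order all_algebra.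
From mathcomp Require Import all_classical all_reals all_analysis.
From mathcomp Require Import ring.
Import Order.TTheory GRing.Theory Num.Theory.
Import numFieldNormedType.Exports.
Local Open Scope ring_scope.

(** Let W^1 = V^1 f_1, W^2 = V^2 f_2, W^3 = c k_3 be the coordinates of V in the
    basis of the coordinate fields d_1, d_2, d_3. The Lie derivative of g along
    V is tensorial in its two arguments ([lie_derivative_metricE]), so V is a
    Killing field exactly when the components of that tensor vanish; since f_1
    and f_2 depend on x^3 only, this says ([killing_pdeE])

      f_1 d_1 W^1 = c k_3 f_1',    f_2 d_2 W^2 = c k_3 f_2',
      d_3 W^1 = d_3 W^2 = 0,       f_1^2 d_1 W^2 + f_2^2 d_2 W^1 = 0.

    All solutions of this system are affine, and no second derivative is
    needed to see it. A shift of the variables that changes W^j by a constant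
    leaves the partial derivatives of W^j unchanged ([partial_shift]). Hence
    d_1 W^1, which is a function of x^3 by the first equation and does not
    change along x^3, is constant, and so is d_2 W^2. Likewise d_2 W^1 is
    unchanged along x^3 and x^1, and also along x^2, because the last equation
    expresses it through d_1 W^2; so d_2 W^1 and d_1 W^2 are constant.
    Therefore ([killing_affineE]) V is Killing if and only if

      W^1 = K_1 x^1 + k x^2 + m_1,     W^2 = l x^1 + K_2 x^2 + m_2

    with f_i K_i = c k_3 f_i' and f_1^2 l + f_2^2 k = 0. The four assertions
    are the cases c = 0 or not, k = 0 or not: if c is nonzero, then f_1 and f_2
    are exponentials ([partial_exp_sol]), and if k is nonzero, then f_1 / f_2
    has a constant square, hence is constant ([ratio_cst]). In the last
    assertion the constants called ct1, ct2 contribute t c_i exp(cb x^3) to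
    W^i, which has to be constant: this is the condition
    cb (ct1^2 + ct2^2) = 0. *)

(** * Directional derivatives and shifts *)

Section Partials.
Context {R : realType}.
Implicit Types (h p : 'rV[R]_3 -> R) (x y v : 'rV[R]_3) (K t : R).

(** Differentiating along v is differentiating one variable on the line
    x + R v; this gives access to the one-variable mean value theorem. *)
Lemma is_derive_line h x v t K :
  is_derive t 1 (fun s : R => h (x + s *: v)) K <->
  is_derive (x + t *: v) v h K.
Proof.
have E : (fun s : R => s^-1 *: (((fun s : R => h (x + s *: v)) \o shift t)
             (s *: (1 : R)) - h (x + t *: v)))
    = (fun s : R => s^-1 *: ((h \o shift (x + t *: v)) (s *: v)
             - h (x + t *: v))).
  apply/funext => s /=; congr (_ *: (h _ - _)).
  by rewrite scalerDl scaler1 addrCA.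
by split=> -[D V]; split; move: D V; rewrite /derivable /derive E.
Qed.

Lemma is_derive_affine_line h x v K :
  (forall t, h (x + t *: v) = h x + t * K) -> is_derive x v h K.
Proof.
move=> hE; rewrite -[x]addr0 -[X in x + X](scale0r v); apply/is_derive_line.
rewrite (_ : (fun _ => _) = cst (h x) + K *: (id : R -> R)); last first.
  by apply/funext => t; rewrite hE mulrC.
have dK := is_deriveZ K (is_derive_id (0 : R) (1 : R)).
apply: is_derive_eq (is_deriveD (is_derive_cst (h x) (0 : R) (1 : R)) dK) _.
by rewrite add0r scaler1.
Qed.

(** A constant derivative along a line forces the function to be affine on
    it. *)
Lemma affine_line h x v K :
  (forall t, is_derive (x + t *: v) v h K) ->
  forall t, h (x + t *: v) = h x + t * K.
Proof.
move=> hD t.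
pose g : R -> R := (fun s : R => h (x + s *: v)) - K *: (id : R -> R).
have : g t = g 0.
  apply: is_derive_0_is_cst => u.
  have hu := (is_derive_line h x v u K).2 (hD u).
  by apply: is_derive_eq; rewrite scaler1 subrr.
rewrite /g !fctE scale0r addr0 scaler0 subr0 => <-.
by rewrite [t * K]mulrC subrK.
Qed.

(** If h changes by a constant under the translation by w, its partial
    derivatives are invariant under that translation. *)
Lemma partial_shift h w K i :
  (forall y, h (y + w) = h y + K) ->
  forall x, partial i h (x + w) = partial i h x.
Proof.
move=> hw x; rewrite /partial /derive.
suff -> : (fun s : R => s^-1 *: ((h \o shift (x + w)) (s *: delta_mx 0 i)
                                 - h (x + w)))
        = (fun s : R => s^-1 *: ((h \o shift x) (s *: delta_mx 0 i) - h x)).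
  by [].
by apply/funext => s /=; rewrite addrA !hw opprD addrACA subrr addr0.
Qed.

Lemma row3E x : x = x 0 i1 *: delta_mx 0 i1 + x 0 i2 *: delta_mx 0 i2
                    + x 0 i3 *: delta_mx 0 i3.
Proof.
rewrite {1}[x]row_sum_delta 3!big_ord_recl big_ord0 addr0 addrA.
by do !(congr (_ + _)); congr (x _ _ *: delta_mx _ _); apply/val_inj.
Qed.

Lemma shift_affine h K1 K2 K3 :
  (forall x t, h (x + t *: delta_mx 0 i1) = h x + t * K1) ->
  (forall x t, h (x + t *: delta_mx 0 i2) = h x + t * K2) ->
  (forall x t, h (x + t *: delta_mx 0 i3) = h x + t * K3) ->
  forall x, h x = K1 * x 0 i1 + K2 * x 0 i2 + K3 * x 0 i3 + h 0.
Proof.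
move=> h1 h2 h3 x; rewrite {1}[x]row3E h3 h2 -[_ *: _]add0r h1.
by ring.
Qed.

Lemma smooth_is_derive h i x :
  smooth h -> is_derive x (delta_mx 0 i) h (partial i h x).
Proof. by move=> /(_ 1%N) [_ /(_ i) [hd _]]; apply/derivableP. Qed.

Lemma is_derive_inv h x v K :
  h x != 0 -> is_derive x v h K ->
  is_derive x v (fun y => (h y)^-1) (- h x ^- 2 *: K).
Proof.
move=> hx [hd <-]; split; first exact: derivableV.
by rewrite deriveV.
Qed.

Lemma derive_partial h x i K :
  is_derive x (delta_mx 0 i) h K -> partial i h x = K.
Proof. by case. Qed.

(** * The Lie derivative of a diagonal metric *)

(** Product rule for g(X, Y): the derivatives of X, of Y, and of the
    coefficients 1 / f_j^2 of the metric. *)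
Lemma is_derive_metric (f1 f2 f3 : 'rV[R]_3 -> R) (X Y : 'rV[R]_3 -> 'rV[R]_3)
    x v (df1 df2 df3 : R) (dX dY : 'rV[R]_3) :
  f1 x != 0 -> f2 x != 0 -> f3 x != 0 ->
  is_derive x v f1 df1 -> is_derive x v f2 df2 -> is_derive x v f3 df3 ->
  (forall j, is_derive x v (fun y => X y 0 j) (dX 0 j)) ->
  (forall j, is_derive x v (fun y => Y y 0 j) (dY 0 j)) ->
  is_derive x v (fun y => metric f1 f2 f3 y (X y) (Y y))
   (metric f1 f2 f3 x dX (Y x) + metric f1 f2 f3 x (X x) dY
    - 2 * (df1 / f1 x ^+ 3 * (X x 0 i1 * Y x 0 i1)
           + df2 / f2 x ^+ 3 * (X x 0 i2 * Y x 0 i2)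
           + df3 / f3 x ^+ 3 * (X x 0 i3 * Y x 0 i3))).
Proof.
move=> n1 n2 n3 d1 d2 d3 DX DY.
pose X1 y := X y 0 i1; pose X2 y := X y 0 i2; pose X3 y := X y 0 i3.
pose Y1 y := Y y 0 i1; pose Y2 y := Y y 0 i2; pose Y3 y := Y y 0 i3.
have DX1 : is_derive x v X1 (dX 0 i1) by exact: DX.
have DX2 : is_derive x v X2 (dX 0 i2) by exact: DX.
have DX3 : is_derive x v X3 (dX 0 i3) by exact: DX.
have DY1 : is_derive x v Y1 (dY 0 i1) by exact: DY.
have DY2 : is_derive x v Y2 (dY 0 i2) by exact: DY.
have DY3 : is_derive x v Y3 (dY 0 i3) by exact: DY.
have I1 := is_derive_inv _ _ _ _ n1 d1.
have I2 := is_derive_inv _ _ _ _ n2 d2.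
have I3 := is_derive_inv _ _ _ _ n3 d3.
rewrite (_ : (fun y => _) =
    (fun y => (f1 y)^-1) ^+ 2 * (X1 * Y1)
    + (fun y => (f2 y)^-1) ^+ 2 * (X2 * Y2)
    + (fun y => (f3 y)^-1) ^+ 2 * (X3 * Y3)); last first.
  by apply/funext => y; rewrite /metric /= !div1r -!exprVn.
have D1 := is_deriveM (is_deriveX 2 I1) (is_deriveM DX1 DY1).
have D2 := is_deriveM (is_deriveX 2 I2) (is_deriveM DX2 DY2).
have D3 := is_deriveM (is_deriveX 2 I3) (is_deriveM DX3 DY3).
apply: is_derive_eq (is_deriveD (is_deriveD D1 D2) D3) _.
rewrite /metric /GRing.scale /= -/(X1 x) -/(X2 x) -/(X3 x).
rewrite -/(Y1 x) -/(Y2 x) -/(Y3 x).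
rewrite !fctE /=.
by field; rewrite n1 n2 n3.
Qed.

Lemma ord3_ind (P : 'I_3 -> Prop) : P i1 -> P i2 -> P i3 -> forall i, P i.
Proof.
move=> P1 P2 P3 [[|[|[|//]]] Hi].
- by rewrite (_ : Ordinal Hi = i1) //; apply/val_inj.
- by rewrite (_ : Ordinal Hi = i2) //; apply/val_inj.
- by rewrite (_ : Ordinal Hi = i3) //; apply/val_inj.
Qed.

Lemma sum3E (F : 'I_3 -> R) : \sum_(i < 3) F i = F i1 + F i2 + F i3.
Proof.
rewrite 3!big_ord_recl big_ord0 addr0 addrA.
by do !(congr (_ + _)); congr F; apply/val_inj.
Qed.

Lemma metricC (f1 f2 f3 : 'rV[R]_3 -> R) x (u v : 'rV[R]_3) :
  metric f1 f2 f3 x u v = metric f1 f2 f3 x v u.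
Proof. by rewrite /metric ![v 0 _ * _]mulrC. Qed.

Lemma metric_lincomb (f1 f2 f3 : 'rV[R]_3 -> R) x (a b : 'I_3 -> R)
    (u v : 'I_3 -> 'rV[R]_3) w :
  metric f1 f2 f3 x (\row_j (\sum_(i < 3) a i * u i 0 j
                             - \sum_(i < 3) b i * v i 0 j)) w =
  \sum_(i < 3) a i * metric f1 f2 f3 x (u i) w
  - \sum_(i < 3) b i * metric f1 f2 f3 x (v i) w.
Proof. by rewrite !sum3E /metric !mxE !sum3E; ring. Qed.

(** The componentwise partial derivative of the field W in the direction of the
    i-th coordinate, at x: the vector with coordinates d_i W^j. *)
Definition dfield (W : 'rV[R]_3 -> 'rV[R]_3) x i : 'rV[R]_3 :=
  \row_j partial i (fun y => W y 0 j) x.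

Lemma dfieldE (W : 'rV[R]_3 -> 'rV[R]_3) x i j :
  dfield W x i 0 j = partial i (fun y => W y 0 j) x.
Proof. by rewrite mxE. Qed.

Lemma lie_bracketE (X Y : 'rV[R]_3 -> 'rV[R]_3) x :
  lie_bracket X Y x =
  \row_j (\sum_(i < 3) X x 0 i * dfield Y x i 0 j
          - \sum_(i < 3) Y x 0 i * dfield X x i 0 j).
Proof.
by apply/rowP => j; rewrite !mxE /vf_apply; congr (_ - _);
  apply: eq_bigr => i _; rewrite mxE.
Qed.

(** The derivatives of X and Y cancel: the Lie derivative of the metric along W
    depends only on the values of X and Y at the point. *)
Lemma lie_derivative_metricE (f1 f2 f3 : 'rV[R]_3 -> R)
    (W X Y : 'rV[R]_3 -> 'rV[R]_3) x :
  f1 x != 0 -> f2 x != 0 -> f3 x != 0 ->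
  smooth f1 -> smooth f2 -> smooth f3 ->
  smooth_field X -> smooth_field Y ->
  lie_derivative_metric (metric f1 f2 f3) W X Y x =
  \sum_(i < 3) (X x 0 i * metric f1 f2 f3 x (dfield W x i) (Y x)
              + Y x 0 i * metric f1 f2 f3 x (X x) (dfield W x i))
  - 2 * (vf_apply W f1 x / f1 x ^+ 3 * (X x 0 i1 * Y x 0 i1)
         + vf_apply W f2 x / f2 x ^+ 3 * (X x 0 i2 * Y x 0 i2)
         + vf_apply W f3 x / f3 x ^+ 3 * (X x 0 i3 * Y x 0 i3)).
Proof.
move=> n1 n2 n3 s1 s2 s3 sX sY.
pose q i : R := partial i f1 x / f1 x ^+ 3 * (X x 0 i1 * Y x 0 i1)
                + partial i f2 x / f2 x ^+ 3 * (X x 0 i2 * Y x 0 i2)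
                + partial i f3 x / f3 x ^+ 3 * (X x 0 i3 * Y x 0 i3).
have dG i : partial i (fun y => metric f1 f2 f3 y (X y) (Y y)) x
   = metric f1 f2 f3 x (dfield X x i) (Y x)
     + metric f1 f2 f3 x (dfield Y x i) (X x) - 2 * q i.
  rewrite [metric _ _ _ _ _ (X x)]metricC; apply: derive_partial.
  have D (f : 'rV[R]_3 -> R) : smooth f ->
      is_derive x (delta_mx 0 i) f (partial i f x).
    exact: smooth_is_derive.
  have DX j : is_derive x (delta_mx 0 i) (fun y => X y 0 j) (dfield X x i 0 j).
    by rewrite mxE; apply: D (sX j).
  have DY j : is_derive x (delta_mx 0 i) (fun y => Y y 0 j) (dfield Y x i 0 j).
    by rewrite mxE; apply: D (sY j).
  exact: is_derive_metric n1 n2 n3 (D _ s1) (D _ s2) (D _ s3) DX DY.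
have qE : \sum_(i < 3) W x 0 i * q i =
    vf_apply W f1 x / f1 x ^+ 3 * (X x 0 i1 * Y x 0 i1)
    + vf_apply W f2 x / f2 x ^+ 3 * (X x 0 i2 * Y x 0 i2)
    + vf_apply W f3 x / f3 x ^+ 3 * (X x 0 i3 * Y x 0 i3).
  rewrite /vf_apply /q !mulr_suml -!big_split /=.
  by apply: eq_bigr => i _; rewrite !mulrDr !mulrA.
rewrite -qE /lie_derivative_metric !lie_bracketE metric_lincomb.
rewrite [metric _ _ _ x (X x) (\row_j _)]metricC metric_lincomb.
rewrite /vf_apply mulr_sumr -!sumrB.
apply: eq_bigr => i _; rewrite dG [metric _ _ _ _ (X x) _]metricC.
by ring.
Qed.

(** * The Killing equations of the metric *)

Lemma smooth_cst (a : R) : smooth (fun _ : 'rV[R]_3 => a).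
Proof.
move=> k; elim: k a => [|k IH] a; split=> //; do 1?exact: cst_continuous.
move=> i; split=> [x|]; first exact: derivable_cst.
suff -> : partial i (fun _ : 'rV[R]_3 => a) = fun=> 0 by exact: IH.
by apply/funext => x; apply: derive_cst.
Qed.

Lemma smooth_coord_field i : smooth_field (@coord_field R i).
Proof. by move=> j; apply: smooth_cst. Qed.

Lemma partial_cst (a : R) i x : partial i (fun=> a) x = 0.
Proof. exact: derive_cst. Qed.

Lemma depends_only_shift h i j :
  depends_only_on i h -> j != i -> forall x t, h (x + t *: delta_mx 0 j) = h x.
Proof.
move=> hi ji x t; apply: hi.
by rewrite !mxE eqxx /= eq_sym (negPf ji) mulr0 addr0.
Qed.

Lemma depends_only_partial h i j x :
  depends_only_on i h -> j != i -> partial j h x = 0.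
Proof.
move=> hi ji; apply: derive_partial; apply: is_derive_affine_line => t.
by rewrite (depends_only_shift _ _ _ hi ji) mulr0 addr0.
Qed.

Section System.
Variables (f1 f2 : 'rV[R]_3 -> R) (k3 w : R) (W : 'rV[R]_3 -> 'rV[R]_3).
Hypotheses (f1_smooth : smooth f1) (f2_smooth : smooth f2).
Hypotheses (f1_neq0 : forall x, f1 x <> 0) (f2_neq0 : forall x, f2 x <> 0).
Hypotheses (f1_x3 : depends_only_on i3 f1) (f2_x3 : depends_only_on i3 f2).
Hypotheses (k3_neq0 : k3 <> 0).

(** The components of the Lie derivative of the metric, for a field whose third
    coordinate is a constant w. *)
Lemma lie_derivative_pdeE (W3_cst : forall x, W x 0 i3 = w)
    (X Y : 'rV[R]_3 -> 'rV[R]_3) x :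
  smooth_field X -> smooth_field Y ->
  lie_derivative_metric (metric f1 f2 (fun=> k3)) W X Y x =
    2 * (X x 0 i1 * Y x 0 i1)
      * (f1 x * partial i1 (fun y => W y 0 i1) x - w * partial i3 f1 x)
      / f1 x ^+ 3
  + 2 * (X x 0 i2 * Y x 0 i2)
      * (f2 x * partial i2 (fun y => W y 0 i2) x - w * partial i3 f2 x)
      / f2 x ^+ 3
  + (X x 0 i1 * Y x 0 i3 + X x 0 i3 * Y x 0 i1)
      * partial i3 (fun y => W y 0 i1) x / f1 x ^+ 2
  + (X x 0 i2 * Y x 0 i3 + X x 0 i3 * Y x 0 i2)
      * partial i3 (fun y => W y 0 i2) x / f2 x ^+ 2
  + (X x 0 i1 * Y x 0 i2 + X x 0 i2 * Y x 0 i1)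
      * (f1 x ^+ 2 * partial i1 (fun y => W y 0 i2) x
         + f2 x ^+ 2 * partial i2 (fun y => W y 0 i1) x)
      / (f1 x ^+ 2 * f2 x ^+ 2).
Proof.
move=> sX sY.
have n1 : f1 x != 0 by apply/eqP.
have n2 : f2 x != 0 by apply/eqP.
have n3 : k3 != 0 by apply/eqP.
rewrite lie_derivative_metricE //; last exact: smooth_cst.
have W3E : (fun y => W y 0 i3) = fun=> w by apply/funext.
have WF f : depends_only_on i3 f -> vf_apply W f x = w * partial i3 f x.
  move=> f_x3; rewrite /vf_apply sum3E W3_cst.
  rewrite (depends_only_partial _ i3 i1) // (depends_only_partial _ i3 i2) //.
  by rewrite !mulr0 !add0r.
have k_x3 : depends_only_on i3 (fun _ : 'rV[R]_3 => k3) by [].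
have dW3 i : dfield W x i 0 i3 = 0 by rewrite dfieldE W3E partial_cst.
rewrite (WF _ f1_x3) (WF _ f2_x3) (WF _ k_x3) partial_cst -!dfieldE.
(* From here on the identity is algebraic in the values at x. *)
move: (dfield W x) (X x) (Y x) dW3 => D u v dW3.
rewrite sum3E /metric !dW3.
move: (partial i3 f1 x) (partial i3 f2 x) (f1 x) (f2 x) n1 n2.
move=> d1 d2 a1 a2 n1 n2.
move: (u 0 i1) (u 0 i2) (u 0 i3) => u1 u2 u3.
move: (v 0 i1) (v 0 i2) (v 0 i3) => v1 v2 v3.
move: (D i1 0 i1) (D i2 0 i1) (D i3 0 i1) => p1 p2 p3.
move: (D i1 0 i2) (D i2 0 i2) (D i3 0 i2) => q1 q2 q3.
by field; rewrite n1 n2 n3.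
Qed.

Lemma killing_pdeE (W3_cst : forall x, W x 0 i3 = w) :
  killing (metric f1 f2 (fun=> k3)) W <->
  forall x,
  [/\ f1 x * partial i1 (fun y => W y 0 i1) x = w * partial i3 f1 x,
      f2 x * partial i2 (fun y => W y 0 i2) x = w * partial i3 f2 x,
      partial i3 (fun y => W y 0 i1) x = 0,
      partial i3 (fun y => W y 0 i2) x = 0
    & f1 x ^+ 2 * partial i1 (fun y => W y 0 i2) x
      + f2 x ^+ 2 * partial i2 (fun y => W y 0 i1) x = 0].
Proof.
have LE := lie_derivative_pdeE W3_cst.
split=> [kW x|sys X Y sX sY x]; last first.
  have [e1 e2 e3 e4 e5] := sys x.
  by rewrite LE // e1 e2 e3 e4 e5 !subrr !(mulr0, mul0r) !addr0.
have n1 : f1 x != 0 by apply/eqP.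
have n2 : f2 x != 0 by apply/eqP.
(* The five equations are the components of the tensor on pairs of coordinate
   fields; the component (3, 3) vanishes identically. *)
have K i j := kW _ _ (smooth_coord_field i) (smooth_coord_field j) x.
have {}LE i j := LE _ _ x (smooth_coord_field i) (smooth_coord_field j).
have cE i j : @coord_field R i x 0 j = (j == i)%:R by rewrite mxE.
have two : 2 != 0 :> R by rewrite pnatr_eq0.
have nz := (mulf_eq0, invr_eq0, expf_eq0, negPf n1, negPf n2, negPf two,
            andbF, orbF).
have simp := (mulr0, mul0r, addr0, add0r, mulr1, mul1r).
split.
- have /eqP := K i1 i1; rewrite LE !cE /= !simp.
  by rewrite !nz /= subr_eq0 => /eqP.
- have /eqP := K i2 i2; rewrite LE !cE /= !simp.
  by rewrite !nz /= subr_eq0 => /eqP.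
- by have /eqP := K i1 i3; rewrite LE !cE /= !simp !nz /= => /eqP.
- by have /eqP := K i2 i3; rewrite LE !cE /= !simp !nz /= => /eqP.
- by have /eqP := K i1 i2; rewrite LE !cE /= !simp !nz /= => /eqP.
Qed.

(** The Killing fields with constant third coordinate: the other two coordinates
    are affine in x^1, x^2, with coefficients tied to f1 and f2. *)
Lemma killing_affineE :
  (forall x, W x 0 i3 = w) ->
  (forall i j x, derivable (fun y => W y 0 j) x (delta_mx 0 i)) ->
  killing (metric f1 f2 (fun=> k3)) W <->
  exists K1 K2 k l m1 m2 : R, forall x,
  [/\ W x 0 i1 = K1 * x 0 i1 + k * x 0 i2 + m1,
      W x 0 i2 = l * x 0 i1 + K2 * x 0 i2 + m2,
      f1 x * K1 = w * partial i3 f1 x, f2 x * K2 = w * partial i3 f2 x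
    & f1 x ^+ 2 * l + f2 x ^+ 2 * k = 0].
Proof.
move=> W3_cst dW; rewrite (killing_pdeE W3_cst).
pose W1 y := W y 0 i1; pose W2 y := W y 0 i2.
rewrite -/W1 -/W2.
have dW1 i x : is_derive x (delta_mx 0 i) W1 (partial i W1 x).
  exact/derivableP/dW.
have dW2 i x : is_derive x (delta_mx 0 i) W2 (partial i W2 x).
  exact/derivableP/dW.
have [f1n f2n] : (forall x, f1 x != 0) /\ (forall x, f2 x != 0).
  by split=> x; apply/eqP.
split=> [sys|[K1 [K2 [k [l [m1 [m2 sol]]]]]] x].
  have W13 x t : W1 (x + t *: delta_mx 0 i3) = W1 x + t * 0.
    apply: affine_line => s.
    by have [_ _ <- _ _] := sys (x + s *: delta_mx 0 i3).
  have W23 x t : W2 (x + t *: delta_mx 0 i3) = W2 x + t * 0.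
    apply: affine_line => s.
    by have [_ _ _ <- _] := sys (x + s *: delta_mx 0 i3).
  have cst h : (forall i x t, h (x + t *: delta_mx 0 i) = h x) ->
      forall x, h x = h 0.
    move=> hc x; rewrite (shift_affine h 0 0 0) ?mul0r ?add0r //;
    by move=> y t; rewrite hc mulr0 addr0.
  have f_shift f i x t : depends_only_on i3 f -> i != i3 ->
      partial i3 f (x + t *: delta_mx 0 i) = partial i3 f x.
    move=> f3 ni; apply: (partial_shift _ _ 0) => y.
    by rewrite (depends_only_shift _ _ _ f3 ni) addr0.
  have p11 x : partial i1 W1 x = w * partial i3 f1 x / f1 x.
    by have [<- _ _ _ _] := sys x; rewrite mulrAC divff // mul1r.
  have p22 x : partial i2 W2 x = w * partial i3 f2 x / f2 x.
    by have [_ <- _ _ _] := sys x; rewrite mulrAC divff // mul1r.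
  have p21 x : partial i2 W1 x = - (f1 x ^+ 2 * partial i1 W2 x) / f2 x ^+ 2.
    have [_ _ _ _ /eqP] := sys x; rewrite addrC addr_eq0 => /eqP <-.
    by rewrite mulrAC divff ?mul1r // expf_neq0.
  have p12 x : partial i1 W2 x = - (f2 x ^+ 2 * partial i2 W1 x) / f1 x ^+ 2.
    have [_ _ _ _ /eqP] := sys x; rewrite addr_eq0 => /eqP <-.
    by rewrite mulrAC divff ?mul1r // expf_neq0.
  (* The first equation makes d_1 W^1 a function of x^3, while W^1 does not
     depend on x^3. *)
  have c11 x : partial i1 W1 x = partial i1 W1 0.
    apply: cst x; elim/ord3_ind => x t.
    - by rewrite !p11 f_shift // (depends_only_shift _ _ _ f1_x3).
    - by rewrite !p11 f_shift // (depends_only_shift _ _ _ f1_x3).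
    - exact: partial_shift (W13 ^~ t) x.
  have c22 x : partial i2 W2 x = partial i2 W2 0.
    apply: cst x; elim/ord3_ind => x t.
    - by rewrite !p22 f_shift // (depends_only_shift _ _ _ f2_x3).
    - by rewrite !p22 f_shift // (depends_only_shift _ _ _ f2_x3).
    - exact: partial_shift (W23 ^~ t) x.
  have W11 x t : W1 (x + t *: delta_mx 0 i1) = W1 x + t * partial i1 W1 0.
    by apply: affine_line => s; rewrite -(c11 (x + s *: delta_mx 0 i1)).
  have W22 x t : W2 (x + t *: delta_mx 0 i2) = W2 x + t * partial i2 W2 0.
    by apply: affine_line => s; rewrite -(c22 (x + s *: delta_mx 0 i2)).
  (* Invariance along x^1 comes from the equation relating d_1 W^2 to d_2 W^1,
     because W^1 is affine along x^1. *)
  have c12 x : partial i1 W2 x = partial i1 W2 0.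
    apply: cst x; elim/ord3_ind => x t.
    - rewrite !p12 (depends_only_shift f1 i3) // (depends_only_shift f2 i3) //.
      by rewrite (partial_shift _ _ _ _ (W11 ^~ t)).
    - exact: partial_shift (W22 ^~ t) x.
    - exact: partial_shift (W23 ^~ t) x.
  have c21 x : partial i2 W1 x = partial i2 W1 0.
    apply: cst x; elim/ord3_ind => x t.
    - exact: partial_shift (W11 ^~ t) x.
    - rewrite !p21 (depends_only_shift f1 i3) // (depends_only_shift f2 i3) //.
      by rewrite (partial_shift _ _ _ _ (W22 ^~ t)).
    - exact: partial_shift (W13 ^~ t) x.
  have W12 x t : W1 (x + t *: delta_mx 0 i2) = W1 x + t * partial i2 W1 0.
    by apply: affine_line => s; rewrite -(c21 (x + s *: delta_mx 0 i2)).
  have W21 x t : W2 (x + t *: delta_mx 0 i1) = W2 x + t * partial i1 W2 0.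
    by apply: affine_line => s; rewrite -(c12 (x + s *: delta_mx 0 i1)).
  exists (partial i1 W1 0), (partial i2 W2 0), (partial i2 W1 0).
  exists (partial i1 W2 0), (W1 0), (W2 0) => x.
  have [e1 e2 _ _ e5] := sys x.
  split.
  - have := shift_affine _ _ _ _ W11 W12 W13 x.
    by rewrite -/(W1 x) mul0r addr0.
  - have := shift_affine _ _ _ _ W21 W22 W23 x.
    by rewrite -/(W2 x) mul0r addr0.
  - by rewrite -(c11 x).
  - by rewrite -(c22 x).
  - by rewrite -(c12 x) -(c21 x).
have W1E y : W1 y = K1 * y 0 i1 + k * y 0 i2 + m1 by have [] := sol y.
have W2E y : W2 y = l * y 0 i1 + K2 * y 0 i2 + m2 by have [] := sol y.
have [_ _ e1 e2 e5] := sol x.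
have shiftE (t : R) i j :
    (x + t *: delta_mx 0 i) 0 j = x 0 j + t * (j == i)%:R.
  by rewrite !mxE.
have pE h i K : (forall t, h (x + t *: delta_mx 0 i) = h x + t * K) ->
    partial i h x = K.
  by move=> hE; apply: derive_partial; apply: is_derive_affine_line.
rewrite (pE W1 i1 K1); last by move=> t; rewrite !W1E !shiftE /=; ring.
rewrite (pE W2 i2 K2); last by move=> t; rewrite !W2E !shiftE /=; ring.
rewrite (pE W1 i3 0); last by move=> t; rewrite !W1E !shiftE /=; ring.
rewrite (pE W2 i3 0); last by move=> t; rewrite !W2E !shiftE /=; ring.
rewrite (pE W2 i1 l); last by move=> t; rewrite !W2E !shiftE /=; ring.
rewrite (pE W1 i2 k) //; last by move=> t; rewrite !W1E !shiftE /=; ring.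
Qed.
End System.

(** * Exponential solutions and constant ratios *)

Lemma partial_exp h (a b : R) :
  (forall x, h x = a * expR (b * x 0 i3)) ->
  forall x, partial i3 h x = b * h x.
Proof.
move=> hE x; apply: derive_partial.
rewrite -[x]addr0 -[X in x + X](scale0r (delta_mx 0 i3)); apply/is_derive_line.
rewrite (_ : (fun _ => _) =
  (a * expR (b * x 0 i3)) *: (expR \o (b *: (id : R -> R)))); last first.
  apply/funext => t; rewrite hE !mxE eqxx /= mulr1 mulrDr expRD mulrA.
  by [].
apply: is_derive_eq.
rewrite /= ?fctE /= ?scaler0 ?expR0 ?scale0r ?addr0 ?hE /GRing.scale /=.
by ring.
Qed.

Lemma partial_exp_sol h (b : R) :
  smooth h -> depends_only_on i3 h -> (forall x, partial i3 h x = b * h x) ->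
  forall x, h x = h 0 * expR (b * x 0 i3).
Proof.
move=> sh h3 hE x.
pose l : R -> R := fun s => h (0 + s *: delta_mx 0 i3).
(* The quotient of h by the exponential, along the third axis, is constant. *)
pose g : R -> R := l * (expR \o (- b *: (id : R -> R))).
have : g (x 0 i3) = g 0.
  apply: is_derive_0_is_cst => t.
  have hl : is_derive t 1 l (b * l t).
    by apply/is_derive_line; rewrite -hE; apply: smooth_is_derive.
  apply: is_derive_eq; rewrite ?fctE /GRing.scale /=.
  by ring.
rewrite /g !fctE /= scaler0 expR0 mulr1 {2}/l scale0r addr0 => <-.
rewrite -mulrA -expRD -[- b *: _]/(- b * _) mulNr addNr expR0 mulr1 /l.
by apply: h3; rewrite !mxE eqxx mulr1 add0r.
Qed.

(** The relation makes the square of h / p constant; as h / p never vanishes,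
    its derivatives vanish, since 2 (h / p) d_i (h / p) = 0. *)
Lemma ratio_cst h p (k l : R) :
  smooth h -> smooth p -> (forall x, p x != 0) -> (forall x, h x != 0) ->
  k != 0 -> (forall x, h x ^+ 2 * l + p x ^+ 2 * k = 0) ->
  exists r : R, forall x, h x = r * p x.
Proof.
move=> sh sp pn hn k0 E.
have l0 : l != 0.
  apply/eqP => l0; have /eqP := E 0; rewrite l0 mulr0 add0r mulf_eq0.
  by rewrite (negPf k0) orbF expf_eq0 (negPf (pn _)) andbF.
pose q := h * (fun x => (p x)^-1).
have q2 : q * q = cst (- k / l).
  apply/funext => x; rewrite /q !fctE.
  have -> : k = - (h x ^+ 2 * l) / p x ^+ 2.
    have /eqP := E x; rewrite addrC addr_eq0 => /eqP <-.
    by rewrite mulrAC divff ?mul1r // expf_neq0.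
  by field; rewrite l0 pn.
have qs i x t : q (x + t *: delta_mx 0 i) = q x + t * 0.
  apply: affine_line => s; set y := _ + _.
  have dh := smooth_is_derive h i y sh.
  have dp := is_derive_inv _ _ _ _ (pn y) (smooth_is_derive p i y sp).
  have dq : is_derive y (delta_mx 0 i) q _ := is_deriveM dh dp.
  have : is_derive y (delta_mx 0 i) (q * q) _ := is_deriveM dq dq.
  rewrite q2 => -[_]; rewrite derive_cst => /esym/eqP.
  rewrite -mulr2n mulrn_eq0 /= -[_ *: _ == 0]/(_ * _ == 0) mulf_eq0.
  have -> /= : (q y == 0) = false.
    by rewrite /q fctE mulf_eq0 invr_eq0 (negPf (hn y)) (negPf (pn y)).
  by move=> /eqP d0; move: dq; rewrite d0.
exists (q 0) => x.
have := shift_affine q 0 0 0 (qs i1) (qs i2) (qs i3) x.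
by rewrite !mul0r !add0r => <-; rewrite /q fctE divfK.
Qed.
End Partials.

(** * Classification of the Killing fields *)

Theorem theorem2p12 (R : realType) (f1 f2 : 'rV[R]_3 -> R) (k3 : R)
    (f1_smooth : smooth f1) (f2_smooth : smooth f2)
    (f1_neq0 : forall x, f1 x <> 0) (f2_neq0 : forall x, f2 x <> 0)
    (f1_x3 : depends_only_on i3 f1) (f2_x3 : depends_only_on i3 f2)
    (k3_neq0 : k3 <> 0)
    (V1 V2 V3 : 'rV[R]_3 -> R) (c : R)
    (V1_smooth : smooth V1) (V2_smooth : smooth V2) (V3_smooth : smooth V3)
    (V3_cst : forall x, V3 x = c) :
  killing (metric f1 f2 (fun=> k3)) (of_frame f1 f2 (fun=> k3) V1 V2 V3) <->
  ((* (A) *)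
   (exists c1 c2 : R, forall x,
      [/\ V1 x = c1 / f1 x, V2 x = c2 / f2 x & V3 x = 0])
   \/
   (* (B) *)
   (exists cb1 cb2 ch1 ch2 c1 c2 : R,
      [/\ c <> 0, c1 <> 0 & c2 <> 0] /\
      forall x,
      [/\ V1 x = (k3 * c * cb1 * x 0 i1 + ch1) / (c1 * expR (cb1 * x 0 i3)),
          V2 x = (k3 * c * cb2 * x 0 i2 + ch2) / (c2 * expR (cb2 * x 0 i3)),
          V3 x = c,
          f1 x = c1 * expR (cb1 * x 0 i3)
        & f2 x = c2 * expR (cb2 * x 0 i3)])
   \/
   (* (C) *)
   (exists c1 c2 k0 : R,
      [/\ k0 <> 0,
          forall x,
          [/\ V1 x = k0 / f2 x * x 0 i2 + c1 / f1 x,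
              V2 x = - (k0 / f1 x) * x 0 i1 + c2 / f2 x
            & V3 x = 0]
        & exists r : R, forall x, f1 x / f2 x = r])
   \/
   (* (D) *)
   (exists cb ch1 ch2 ct1 ct2 c1 c2 k0 : R,
      [/\ c <> 0, c1 <> 0, c2 <> 0 & k0 <> 0] /\
      (forall x,
      [/\ V1 x = k0 / (c2 * expR (cb * x 0 i3)) * x 0 i2
                 + (k3 * c * cb * x 0 i1 + ch1) / (c1 * expR (cb * x 0 i3))
                 + ct1,
          V2 x = - (k0 / (c1 * expR (cb * x 0 i3))) * x 0 i1
                 + (k3 * c * cb * x 0 i2 + ch2) / (c2 * expR (cb * x 0 i3))
                 + ct2,
          V3 x = c,
          f1 x = c1 * expR (cb * x 0 i3)
        & f2 x = c2 * expR (cb * x 0 i3)]) /\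
      cb * (ct1 ^+ 2 + ct2 ^+ 2) = 0)).
Proof.
have f1n x : f1 x != 0 by apply/eqP.
have f2n x : f2 x != 0 by apply/eqP.
have k3n : k3 != 0 by apply/eqP.
set W := of_frame _ _ _ _ _ _.
have WE1 x : W x 0 i1 = V1 x * f1 x.
  by rewrite !mxE /= mulr1 !mulr0 !addr0.
have WE2 x : W x 0 i2 = V2 x * f2 x.
  by rewrite !mxE /= mulr1 !mulr0 addr0 add0r.
have WE3 x : W x 0 i3 = c * k3.
  by rewrite !mxE /= mulr1 !mulr0 !add0r V3_cst.
have dW i j x : derivable (fun y => W y 0 j) x (delta_mx 0 i).
  have dV (V f : 'rV[R]_3 -> R) : smooth V -> smooth f ->
      derivable (fun y => V y * f y) x (delta_mx 0 i).
    move=> sV sf; apply: derivableM.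
      by have [] := smooth_is_derive V i x sV.
    by have [] := smooth_is_derive f i x sf.
  elim/ord3_ind: j.
  - by rewrite (funext WE1); apply: dV.
  - by rewrite (funext WE2); apply: dV.
  - by rewrite (funext WE3); apply: derivable_cst.
rewrite (killing_affineE _ _ _ _ W f1_smooth f2_smooth f1_neq0 f2_neq0
           f1_x3 f2_x3 k3_neq0 WE3 dW).
have e_neq0 (b t : R) : expR (b * t) != 0 by rewrite gt_eqF ?expR_gt0.
split=> [[K1 [K2 [k [l [m1 [m2 sol]]]]]]|].
  have V1E x : V1 x = (K1 * x 0 i1 + k * x 0 i2 + m1) / f1 x.
    by have [<- _ _ _ _] := sol x; rewrite WE1 mulfK.
  have V2E x : V2 x = (l * x 0 i1 + K2 * x 0 i2 + m2) / f2 x.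
    by have [_ <- _ _ _] := sol x; rewrite WE2 mulfK.
  have kl x : f1 x ^+ 2 * l + f2 x ^+ 2 * k = 0 by have [] := sol x.
  have l0 : k = 0 -> l = 0.
    move=> k0; have /eqP := kl 0.
    by rewrite k0 mulr0 addr0 mulf_eq0 expf_eq0 (negPf (f1n _)) /= => /eqP.
  have ratio : k != 0 -> exists2 r : R, r != 0 &
      (forall x, f1 x = r * f2 x) /\ l = - k / r ^+ 2.
    move=> k0.
    have [r rE] := ratio_cst f1 f2 k l f1_smooth f2_smooth f2n f1n k0 kl.
    have r0 : r != 0.
      by apply: contraNneq (f1n 0) => r0; rewrite rE r0 mul0r.
    exists r => //; split=> //.
    have kE : k = - (r ^+ 2 * l).
      apply: (mulfI (expf_neq0 2 (f2n 0))); apply/eqP.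
      rewrite mulrN -addr_eq0 addrC mulrA -exprMn [f2 0 * r]mulrC -rE.
      by rewrite kl.
    by rewrite kE opprK mulrAC divff ?mul1r // expf_neq0.
  (* c = 0: assertion (A) if k = 0, assertion (C) otherwise. *)
  have [c0|c0] := eqVneq c 0.
    have K0 (f : 'rV[R]_3 -> R) K : f 0 != 0 ->
        f 0 * K = c * k3 * partial i3 f 0 -> K = 0.
      by move=> fn /eqP; rewrite c0 !mul0r mulf_eq0 (negPf fn) => /eqP.
    have [_ _ /(K0 _ _ (f1n 0)) K10 /(K0 _ _ (f2n 0)) K20 _] := sol 0.
    have [k0|k0] := eqVneq k 0.
      left; exists m1, m2 => x.
      by rewrite V1E V2E V3_cst K10 K20 k0 (l0 k0) !mul0r !add0r.
    right; right; left; have [r r0 [rE lE]] := ratio k0.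
    exists m1, m2, (k / r); split.
    - by apply/eqP; rewrite mulf_neq0 // invr_eq0.
    - move=> x; rewrite V1E V2E V3_cst K10 K20 lE rE.
      by split=> //; field; rewrite r0 f2n.
    - by exists r => x; rewrite rE mulfK.
  (* c <> 0: assertion (B) if k = 0, assertion (D) otherwise. *)
  have w0 : c * k3 != 0 by rewrite mulf_neq0.
  have fE (f : 'rV[R]_3 -> R) K : smooth f -> depends_only_on i3 f ->
      (forall x, f x * K = c * k3 * partial i3 f x) ->
      forall x, f x = f 0 * expR (K / (c * k3) * x 0 i3).
    move=> sf f3 E; apply: partial_exp_sol => // x.
    by apply: (mulfI w0); rewrite -E mulrCA mulrA divfK // mulrC.
  have e1 x : f1 x * K1 = c * k3 * partial i3 f1 x by have [] := sol x.
  have e2 x : f2 x * K2 = c * k3 * partial i3 f2 x by have [] := sol x.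
  have f1E := fE f1 K1 f1_smooth f1_x3 e1.
  have f2E := fE f2 K2 f2_smooth f2_x3 e2.
  have [k0|k0] := eqVneq k 0.
    right; left.
    exists (K1 / (c * k3)), (K2 / (c * k3)), m1, m2, (f1 0), (f2 0).
    split; first by split; apply/eqP.
    move=> x; rewrite -f1E -f2E V1E V2E V3_cst k0 (l0 k0).
    by split=> //; field; rewrite ?f1n ?f2n k3n c0.
  right; right; right; have [r r0 [rE lE]] := ratio k0.
  (* A constant ratio makes the two exponential rates equal. *)
  have K12 : K2 = K1.
    apply: (mulfI (f1n 0)); rewrite e1.
    have -> : partial i3 f1 0 = r * partial i3 f2 0.
      apply: derive_partial; rewrite (_ : f1 = r *: f2); last first.
        by apply/funext => x; rewrite rE.
      exact: is_deriveZ (smooth_is_derive f2 i3 0 f2_smooth).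
    by rewrite mulrCA -e2 rE mulrA.
  rewrite K12 in f2E V2E.
  (* Every solution is reached with ct1 = ct2 = 0. *)
  exists (K1 / (c * k3)), m1, m2, 0, 0, (f1 0), (f2 0), (k / r).
  split; first by split; apply/eqP; rewrite ?mulf_neq0 ?invr_eq0.
  split; last by rewrite expr0n /= addr0 mulr0.
  move=> x; rewrite -f1E -f2E V1E V2E V3_cst lE rE.
  by split=> //; field; rewrite ?f2n ?r0 ?k3n ?c0.
have dE (f : 'rV[R]_3 -> R) (a b : R) :
    (forall x, f x = a * expR (b * x 0 i3)) ->
    forall x, f x * (c * k3 * b) = c * k3 * partial i3 f x.
  by move=> fE x; rewrite (partial_exp f a b fE); ring.
case=> [[c1 [c2 A]]|
  [[b1 [b2 [h1 [h2 [c1 [c2 [_ B]]]]]]]|[[c1 [c2 [k0 [k0n C [r rE]]]]]|]]].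
- have c0 : c = 0 by have [_ _ <-] := A 0; rewrite V3_cst.
  exists 0, 0, 0, 0, c1, c2 => x; have [e1 e2 _] := A x.
  by rewrite WE1 WE2 e1 e2 !divfK // c0 !(mul0r, mulr0) !add0r.
- exists (c * k3 * b1), (c * k3 * b2), 0, 0, h1, h2 => x.
  rewrite (dE f1 c1) => [|y]; last by have [] := B y.
  rewrite (dE f2 c2) => [|y]; last by have [] := B y.
  rewrite WE1 WE2; have [-> -> _ <- <-] := B x.
  by rewrite !divfK // !(mul0r, mulr0) !addr0 add0r; split=> //; ring.
- have c0 : c = 0 by have [_ _ <-] := C 0; rewrite V3_cst.
  have f1E x : f1 x = r * f2 x by rewrite -(rE x) divfK.
  have r0 : r != 0 by apply: contraNneq (f1n 0) => r0; rewrite f1E r0 mul0r.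
  exists 0, 0, (k0 * r), (- k0 / r), c1, c2 => x; have [e1 e2 _] := C x.
  rewrite WE1 WE2 e1 e2 f1E c0 !(mul0r, mulr0).
  by split=> //; field; rewrite ?f2n ?r0.
move=> [b [h1 [h2 [t1 [t2 [c1 [c2 [k0 [[cn c1n c2n k0n] [D bt]]]]]]]]]].
have c1n' : c1 != 0 by apply/eqP.
have c2n' : c2 != 0 by apply/eqP.
(* As b t1 = b t2 = 0, the term t exp(b x^3) is constant. *)
have tE (t : R) x : b * t = 0 -> t * expR (b * x) = t.
  move=> /eqP; rewrite mulf_eq0 => /orP[] /eqP ->; last by rewrite mul0r.
  by rewrite mul0r expR0 mulr1.
have [bt1 bt2] : b * t1 = 0 /\ b * t2 = 0.
  move/eqP: bt; rewrite mulf_eq0 paddr_eq0 ?sqr_ge0 // !expf_eq0 /=.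
  by case/orP=> [/eqP ->|/andP[/eqP -> /eqP ->]]; rewrite ?mul0r ?mulr0.
exists (c * k3 * b), (c * k3 * b), (k0 * c1 / c2), (- k0 * c2 / c1).
exists (h1 + t1 * c1), (h2 + t2 * c2) => x.
rewrite (dE f1 c1) => [|y]; last by have [] := D y.
rewrite (dE f2 c2) => [|y]; last by have [] := D y.
rewrite WE1 WE2; have [-> -> _ -> ->] := D x.
split=> //; last by field; rewrite c1n' c2n'.
- rewrite -{2}(tE t1 (x 0 i3) bt1); field.
  by rewrite c1n' c2n' e_neq0.
- rewrite -{2}(tE t2 (x 0 i3) bt2); field.
  by rewrite c1n' c2n' e_neq0.
Qed.
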